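(* Let $m$ and $n$ be non-negative integers and let $G$ be a locally graded group having exactly $m$ subgroups that are not nilpotent of class at most $n$. Then $G$ has a normal subgroup $S$ which is soluble of derived length at most $[\log_2(n)]+m+3$ such that $G/S$ is finite of order at most $m!$.
   Context: A group $G$ is locally graded if every non-trivial finitely generated subgroup of $G$ has a non-trivial finite homomorphic image. $[x]$ denotes the integer part of $x$. A subgroup is ''not nilpotent of class at most $n$'' if it is either non-nilpotent or nilpotent of class greater than $n$. *)

(* Defs.v *)
From Stdlib Require List.
From mathcomp Require Import all_boot all_fingroup.
Set Implicit Arguments. Unset Strict Implicit. Unset Printing Implicit Defensive.

Record Grp := MkGrp {
  carrier :> Type;
  gmul : carrier -> carrier -> carrier;
  gone : carrier;
  ginv : carrier -> carrier;
  gmulA : forall x y z, gmul x (gmul y z) = gmul (gmul x y) z;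
  gmul1 : forall x, gmul gone x = x;
  gmulV : forall x, gmul (ginv x) x = gone
}.

Section Defs.
Variable G : Grp.
Local Notation "x * y" := (gmul x y).
Local Notation "1" := (gone G).
Local Notation "x ^-1" := (ginv x).

Definition subgroup (H : G -> Prop) : Prop :=
  H 1 /\ (forall x y, H x -> H y -> H (x * y)) /\ (forall x, H x -> H (x ^-1)).

Definition gnormal (S : G -> Prop) : Prop :=
  subgroup S /\ forall g x, S x -> S (g ^-1 * x * g).

Definition ggen (A : G -> Prop) : G -> Prop :=
  fun x => forall K, subgroup K -> (forall a, A a -> K a) -> K x.

Definition fin_generated (H : G -> Prop) : Prop :=
  exists l : list G, forall x, H x <-> ggen (fun a => List.In a l) x.

Definition gtrivial (H : G -> Prop) : Prop := forall x, H x -> x = 1.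

Definition gcomm (x y : G) : G := x ^-1 * y ^-1 * x * y.

Definition gcommg (A B : G -> Prop) : G -> Prop :=
  ggen (fun z => exists a b, A a /\ B b /\ z = gcomm a b).

Fixpoint lcs (H : G -> Prop) (i : nat) : G -> Prop :=
  match i with 0 => H | i'.+1 => gcommg (lcs H i') H end.

Definition nilpotent_class_le (n : nat) (H : G -> Prop) : Prop :=
  gtrivial (lcs H n).

Fixpoint derived (H : G -> Prop) (i : nat) : G -> Prop :=
  match i with 0 => H | i'.+1 => gcommg (derived H i') (derived H i') end.

Definition soluble_dl_le (d : nat) (H : G -> Prop) : Prop :=
  gtrivial (derived H d).

Definition has_nontriv_finite_image (H : G -> Prop) : Prop :=
  exists (gT : finGroupType) (f : G -> gT),
    (forall x y, H x -> H y -> f (x * y) = (f x * f y)%g) /\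
    (exists x, H x /\ f x <> 1%g).

Definition locally_graded : Prop :=
  forall H, subgroup H -> fin_generated H -> ~ gtrivial H ->
    has_nontriv_finite_image H.

Definition same_set (A B : G -> Prop) : Prop := forall x, A x <-> B x.

Definition exactly_subgroups (m : nat) (P : (G -> Prop) -> Prop) : Prop :=
  exists l : list (G -> Prop),
    length l = m /\
    (forall H, List.In H l -> subgroup H /\ P H) /\
    (forall H, subgroup H -> P H -> exists K, List.In K l /\ same_set H K) /\
    (forall i j, i < length l -> j < length l ->
        same_set (List.nth i l (fun _ => False)) (List.nth j l (fun _ => False)) -> i = j).

(* |G/S| is finite and at most k: the cosets of S are covered by at most
   k representatives *)
Definition quotient_order_le (S : G -> Prop) (k : nat) : Prop :=
  exists l : list G, length l <= k /\
    forall g, exists x, List.In x l /\ S (x ^-1 * g).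

End Defs.

(* Main.v *)
Require Import Defs.
From Stdlib Require List.
From mathcomp Require Import all_boot all_fingroup all_solvable.
From mathcomp Require Import frobenius zify boolp.
Set Implicit Arguments. Unset Strict Implicit. Unset Printing Implicit Defensive.

(** Call a subgroup bad if it is not nilpotent of class at most [n].  The group
    acts by conjugation on its [m] bad subgroups; the kernel [S] of this action
    has index at most [m!] and normalises every bad subgroup.  If [S] is not bad,
    its derived length is at most [log2 n + 1].  Otherwise [m >= 1] and [S]
    contains a minimal bad subgroup [M].  Every subgroup between [M] and [S] is
    bad, so [S / M] is a Dedekind group and [S''] lies in [M].  If [M] were not
    finitely generated, its finitely generated subgroups, hence [M] itself, would
    have class at most [n]; so [M] has a nontrivial finite image.  The proper
    subgroups of this image are nilpotent, so it is soluble by Schmidt's theorem.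
    Hence [M'] is a proper subgroup of [M], so it has class at most [n], and [S]
    has derived length at most [2 + 1 + (log2 n + 1)]. *)

(** * Finite simple insoluble groups with all proper subgroups nilpotent: a contradiction *)

Section MinimalNonNilpotent.
Local Open Scope group_scope.
Variables (gT : finGroupType) (G : {group gT}).
Hypothesis nilG : forall H : {group gT}, H \proper G -> nilpotent H.
Hypothesis simG : forall N : {group gT}, N <| G -> N :!=: 1 -> N :=: G.
Hypothesis nsolG : ~~ solvable G.

(** Take a counterexample with largest intersection [I]. By simplicity ['N_G(I)] lies in some
    maximal [H3]. Normalisers grow in the nilpotent [H1], so [H1 :&: H3] exceeds [I], which forces
    [H1 = H3]; likewise [H2 = H3]. *)
Lemma maximal_capg1 (H1 H2 : {group gT}) :
  maximal H1 G -> maximal H2 G -> H1 :!=: H2 -> H1 :&: H2 = 1.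
Proof.
have [k] := ubnP (#|G| - #|H1 :&: H2|).
elim: k H1 H2 => // k IHk H1 H2 lek max1 max2 neq12.
have [//|ntI] := eqVneq (H1 :&: H2) 1; case/negP: (neq12).
have [pr1 pr2] := (maxgroupp max1, maxgroupp max2).
have sIG : H1 :&: H2 \subset G by rewrite subIset // (proper_sub pr1).
have ltIG : #|H1 :&: H2| < #|G|.
  by apply: leq_ltn_trans (proper_card pr1); rewrite subset_leq_card ?subsetIl.
have prN : 'N_G(H1 :&: H2) \proper G.
  rewrite properEneq subsetIl andbT; apply/eqP=> defN.
  have nI : (H1 :&: H2) <| G by rewrite /normal sIG -{1}defN subsetIr.
  by have := simG nI ntI => /= eqIG; rewrite eqIG ltnn in ltIG.
have [H3 max3 sN3] : {H3 : {group gT} | maximal H3 G & 'N_G(H1 :&: H2) \subset H3}.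
  by have [H3 max3 s3] := maxgroup_exists (gP := fun K : {group gT} => K \proper G) prN;
     exists H3.
have key (H H' : {group gT}) : maximal H G -> maximal H' G -> H :!=: H' ->
    H :&: H' = H1 :&: H2 -> H :=: H3.
  move=> maxH maxH' neqH defI; apply/eqP/negPn/negP => neq3.
  have prI : H1 :&: H2 \proper H.
    rewrite -defI properEneq subsetIl andbT; apply/eqP=> /setIidPl sHH'.
    case/eqP: neqH; apply/esym; have [_ maxP] := maxgroupP maxH.
    by rewrite (maxP H') // (maxgroupp maxH').
  have prN3 : H1 :&: H2 \proper H :&: H3.
    apply: proper_sub_trans (nilpotent_proper_norm (nilG (maxgroupp maxH)) prI) _.
    rewrite subsetI subsetIl (subset_trans _ sN3) // setSI //.
    exact: proper_sub (maxgroupp maxH).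
  have := proper_card prN3 => ltc.
  have I1 : H :&: H3 = 1 by apply: IHk => //; apply: leq_trans (ltn_sub2l ltIG ltc) lek.
  by move: prN3; rewrite I1 properE sub1G andbF.
have eq1 : H1 :=: H3 by apply: (key H1 H2).
have eq2 : H2 :=: H3 by apply: (key H2 H1); rewrite 1?eq_sym // setIC.
by apply/eqP; apply: etrans eq1 (esym eq2).
Qed.

Lemma maximal_norm (H : {group gT}) : maximal H G -> H :!=: 1 -> 'N_G(H) = H.
Proof.
move=> maxH ntH; have [prH maxP] := maxgroupP maxH; have sHG := proper_sub prH.
have [prN|] := boolP ('N_G(H) \proper G).
  by apply: maxP => //; rewrite subsetI sHG normG.
rewrite properE subsetIl /= negbK subsetI subxx /= => nHG.
have nH : H <| G by rewrite /normal sHG.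
by move: prH; rewrite (simG nH ntH) properxx.
Qed.

(** Conjugates of [H] are again maximal, so distinct ones meet trivially, and [H] is its own
    normaliser. *)
Lemma maximal_normedTI (H : {group gT}) :
  maximal H G -> H :!=: 1 -> normedTI H^# G H.
Proof.
move=> maxH ntH; apply/normedTI_memJ_P; split.
- by rewrite setD_eq0 subG1.
- exact: proper_sub (maxgroupp maxH).
move=> x g /setD1P[ntx Hx] Gg; rewrite !inE conjg_eq1 ntx /=.
apply/idP/idP => [Hxg | Hg]; last by rewrite memJ_norm // (subsetP (normG H)).
rewrite -(maximal_norm maxH ntH) inE Gg /=; apply/normP/eqP/negPn/negP => neq.
have maxHg : maximal (H :^ g)%G G.
  by rewrite -(maximalJ _ _ g) in maxH; rewrite /= (normP (subsetP (normG G) g Gg)) in maxH.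
have := maximal_capg1 maxHg maxH neq => /= /setP/(_ (x ^ g)).
by rewrite !inE memJ_conjg Hx Hxg conjg_eq1 (negbTE ntx).
Qed.

Lemma maximal_class_support (H : {group gT}) : maximal H G -> H :!=: 1 ->
  (#|class_support H^# G| + #|G : H| = #|G|)%N.
Proof.
move=> maxH ntH; rewrite (card_support_normedTI (maximal_normedTI maxH ntH)).
rewrite -(Lagrange (proper_sub (maxgroupp maxH))) (cardsD1 1 H) group1.
by rewrite mulnDl mul1n addnC.
Qed.

Lemma mem_maximal x : x \in G -> exists2 H : {group gT}, maximal H G & x \in H.
Proof.
move=> Gx; have prx : <[x]> \proper G.
  rewrite properEneq cycle_subG Gx andbT; apply: contraNneq nsolG => <-.
  exact: abelian_sol (cycle_abelian x).
have [H maxH sxH] := maxgroup_exists (gP := fun K : {group gT} => K \proper G) prx.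
by exists H => //; rewrite -cycle_subG.
Qed.

(* Each conjugacy class of maximal subgroups covers at least half of [G^#],
   but none covers all of it. *)
Lemma minimal_nonnilpotent_simple_false : False.
Proof.
have ntG : G :!=: 1 by apply: contraNneq nsolG => ->; exact: solvable1.
have [x0 Gx0 ntx0] := trivgPn _ ntG.
have [H maxH Hx0] := mem_maximal Gx0.
have ntH : H :!=: 1 by apply/trivgPn; exists x0.
have prH := maxgroupp maxH.
have sDG (L : {group gT}) : L \proper G -> class_support L^# G \subset G^#.
  move=> prL; apply/subsetP => _ /imset2P[h g /setD1P[nth Lh] Gg ->].
  by rewrite !inE conjg_eq1 nth groupJ // (subsetP (proper_sub prL)).
have sH := sDG H prH.
have idxH : 1 < #|G : H| by rewrite indexg_gt1 proper_subn.
have cH := maximal_class_support maxH ntH.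
have cG : #|G^#|.+1 = #|G| by rewrite (cardsD1 1 G) group1.
(* The support has [#|G| - #|G : H|] elements, fewer than [#|G| - 1]. *)
have [x Gx nHx] : exists2 x, x \in G^# & x \notin class_support H^# G.
  apply/subsetPn/negP => sG; have := subset_leq_card sG.
  by rewrite leqNgt -ltnS cG -cH -addn1 ltn_add2l idxH.
case/setD1P: Gx => ntx Gx; have [K maxK Kx] := mem_maximal Gx.
have ntK : K :!=: 1 by apply/trivgPn; exists x.
have prK := maxgroupp maxK.
have sK := sDG K prK.
have cK := maximal_class_support maxK ntK.
have maxJ (L : {group gT}) g : maximal L G -> g \in G -> maximal (L :^ g)%G G.
  move=> maxL Gg; rewrite -(maximalJ _ _ g) in maxL.
  by rewrite /= (normP (subsetP (normG G) g Gg)) in maxL.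
have dHK : class_support H^# G :&: class_support K^# G = set0.
  apply/setP => y; rewrite !inE; apply/negP => /andP[].
  case/imset2P=> h g /setD1P[nth Hh] Gg -> /imset2P[k g' /setD1P[ntk Kk] Gg' eqy].
  (* Equal conjugates would put [x] into a conjugate of [H]; distinct ones share no nontrivial
     element. *)
  have [eqHK|neq] := eqVneq (H :^ g) (K :^ g').
    case/negP: nHx; rewrite class_supportEr; apply/bigcupP; exists (g * g'^-1).
      by rewrite groupM ?groupV.
    by rewrite conjD1g !inE ntx conjsgM eqHK conjsgK.
  have := maximal_capg1 (maxJ _ _ maxH Gg) (maxJ _ _ maxK Gg') neq.
  move=> /= /setP/(_ (h ^ g)); rewrite !inE memJ_conjg Hh eqy memJ_conjg Kk.
  by rewrite conjg_eq1 (negbTE ntk).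
have := cardsUI (class_support H^# G) (class_support K^# G).
rewrite dHK cards0 addn0 => cU.
have : class_support H^# G :|: class_support K^# G \subset G^# by rewrite subUset sH.
move/subset_leq_card; rewrite cU => le.
(* Both indices are at most half of [#|G|], so the two disjoint supports have at least [#|G|]
   elements, too many for [G^#]. *)
have half (L : {group gT}) : L \proper G -> L :!=: 1 -> #|G : L| * 2 <= #|G|.
  by move=> prL ntL; rewrite -(Lagrange (proper_sub prL)) mulnC leq_mul2r cardG_gt1 ntL orbT.
move: (half H prH ntH) (half K prK ntK) le cH cK cG; clear.
move: #|G : H| #|G : K| #|G| #|G^#| #|class_support _ _| #|class_support _ _|.
by move=> *; lia.
Qed.

End MinimalNonNilpotent.

(** In a minimal counterexample a nontrivial proper normal [N] is nilpotent, and [G / N] inherits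
    the hypothesis and so is soluble. Hence [G] is simple, which was excluded. *)
Theorem solvable_proper_nilpotent (gT : finGroupType) (G : {group gT}) :
  (forall H : {group gT}, H \proper G -> nilpotent H) -> solvable G.
Proof.
have [k] := ubnP #|G|; elim: k gT G => // k IHk gT G lek nilG.
apply/negPn/negP => nsolG; apply: (minimal_nonnilpotent_simple_false nilG _ nsolG).
move=> N nNG ntN; apply/eqP/negPn/negP => neqNG; case/negP: nsolG.
have prN : N \proper G by rewrite properEneq neqNG normal_sub.
rewrite (series_sol nNG) (nilpotent_sol (nilG N prN)) /=.
apply: IHk => [|L prL]; first by apply: leq_trans (ltn_quotient ntN (normal_sub nNG)) _.
have [H defL sNH sHG] := inv_quotientS nNG (proper_sub prL).
rewrite defL quotient_nil // nilG // properEneq sHG andbT.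
by apply: contraTneq prL => eqHG; rewrite defL eqHG properxx.
Qed.

(** * Identities, generated subgroups and commutator series in abstract groups *)

Section Groups.
Variable G : Grp.
Local Notation "x * y" := (gmul x y).
Local Notation "1" := (gone G).
Local Notation "x ^-1" := (ginv x).
Implicit Types (x y z g h : G) (H K M N S A : G -> Prop).

Lemma gmulKV x y : x^-1 * (x * y) = y.
Proof. by rewrite gmulA gmulV gmul1. Qed.

Lemma gmulI x y z : x * y = x * z -> y = z.
Proof. by move=> e; rewrite -(gmulKV x y) e gmulKV. Qed.

Lemma gmulr1 x : x * 1 = x.
Proof. by apply: (@gmulI x^-1); rewrite gmulA gmulV gmul1. Qed.

Lemma gmulrV x : x * x^-1 = 1.
Proof. by apply: (@gmulI x^-1); rewrite gmulKV gmulr1. Qed.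

Lemma gmulVK x y : x * (x^-1 * y) = y.
Proof. by rewrite gmulA gmulrV gmul1. Qed.

Lemma ginvK x : x^-1^-1 = x.
Proof. by apply: (@gmulI x^-1); rewrite gmulrV gmulV. Qed.

Lemma ginvM x y : (x * y)^-1 = y^-1 * x^-1.
Proof.
by apply: (@gmulI (x * y)); rewrite gmulrV -gmulA gmulVK gmulrV.
Qed.

Lemma ginv1 : 1^-1 = 1.
Proof. by rewrite -[LHS]gmul1 gmulrV. Qed.

Lemma gmulAr x y z : x * y * z = x * (y * z).
Proof. by rewrite gmulA. Qed.

(** A rewriting system that associates products to the right and cancels inverses; it settles the
    word identities below. *)
Definition gE :=
  (ginvM, ginvK, ginv1, gmulAr, gmul1, gmulr1, gmulV, gmulrV, gmulKV, gmulVK).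

Definition gconj x g := g^-1 * x * g.

Lemma gconjM x g h : gconj x (g * h) = gconj (gconj x g) h.
Proof. by rewrite /gconj !gE. Qed.

Lemma gconjMl x y g : gconj (x * y) g = gconj x g * gconj y g.
Proof. by rewrite /gconj !gE. Qed.

Lemma gconjV x g : gconj x^-1 g = (gconj x g)^-1.
Proof. by rewrite /gconj !gE. Qed.

Lemma gconj1 x : gconj x 1 = x.
Proof. by rewrite /gconj !gE. Qed.

Lemma gconj1l g : gconj 1 g = 1.
Proof. by rewrite /gconj !gE. Qed.

Lemma gconjK x g : gconj (gconj x g) g^-1 = x.
Proof. by rewrite -gconjM gmulrV gconj1. Qed.

Lemma gconjVK x g : gconj (gconj x g^-1) g = x.
Proof. by rewrite -gconjM gmulV gconj1. Qed.

Lemma gcommE x y : gcomm x y = x^-1 * gconj x y.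
Proof. by rewrite /gcomm /gconj !gE. Qed.

Lemma gcommJ x y g : gconj (gcomm x y) g = gcomm (gconj x g) (gconj y g).
Proof. by rewrite /gcomm /gconj !gE. Qed.

Lemma gcommV x y : (gcomm x y)^-1 = gcomm y x.
Proof. by rewrite /gcomm !gE. Qed.

(** If two of the factors lie in a subgroup, so does the third; [lcs_comm] uses it in this way. *)
Lemma Hall_Witt x y z :
  gconj (gcomm (gcomm x y^-1) z) y * gconj (gcomm (gcomm y z^-1) x) z *
  gconj (gcomm (gcomm z x^-1) y) x = 1.
Proof. by rewrite /gcomm /gconj !gE. Qed.

Definition gsub A H := forall x, A x -> H x.

Definition gnormalised N H := forall g x, H g -> N x -> N (gconj x g).

Lemma subgroup_conj H g x : subgroup H -> H g -> H x -> H (gconj x g).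
Proof. by case=> h1 [hM hV] Hg Hx; apply: (hM) => //; apply: (hM) => //; apply: hV. Qed.

Lemma subgroup_comm H x y : subgroup H -> H x -> H y -> H (gcomm x y).
Proof.
move=> sH Hx Hy; rewrite gcommE; have [h1 [hM hV]] := sH.
by apply: hM; [apply: hV | apply: subgroup_conj].
Qed.

Lemma gnormalised_mem N H g x : subgroup H -> gnormalised N H -> H g ->
  N (gconj x g) -> N x.
Proof.
by move=> [_ [_ hV]] nN Hg Nxg; rewrite -(gconjK x g); apply: nN => //; apply: hV.
Qed.

(** This predicate is the conjugate $gHg^{-1}$, written as a preimage to avoid an existential. *)
Lemma subgroup_preconj H g : subgroup H -> subgroup (fun x => H (gconj x g)).
Proof.
move=> [h1 [hM hV]]; split; first by rewrite gconj1l.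
by split=> [x y|x]; rewrite ?gconjMl ?gconjV; [apply: hM | apply: hV].
Qed.

Lemma subgroup_ggen A : subgroup (ggen A).
Proof.
split; first by move=> K [].
split=> [x y gx gy K sK sA | x gx K sK sA]; have [_ [hM hV]] := sK.
  by apply: hM; [apply: gx | apply: gy].
by apply: hV; apply: gx.
Qed.

Lemma ggen_mem A x : A x -> ggen A x.
Proof. by move=> Ax K _; apply. Qed.

Lemma ggen_sub A K : subgroup K -> gsub A K -> gsub (ggen A) K.
Proof. by move=> sK sA x; apply. Qed.

Lemma ggen_mono A B : gsub A B -> gsub (ggen A) (ggen B).
Proof.
by move=> sAB; apply: ggen_sub (subgroup_ggen B) _ => x /sAB; apply: ggen_mem.
Qed.

Lemma gcommg_sub A B K : subgroup K ->
  (forall a b, A a -> B b -> K (gcomm a b)) -> gsub (gcommg A B) K.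
Proof. by move=> sK sAB; apply: ggen_sub => // z [a [b [Aa [Bb ->]]]]; apply: sAB. Qed.

Lemma gcommg_mem A B a b : A a -> B b -> gcommg A B (gcomm a b).
Proof. by move=> Aa Bb; apply: ggen_mem; exists a, b. Qed.

Lemma gcommg_mono A B A' B' :
  gsub A A' -> gsub B B' -> gsub (gcommg A B) (gcommg A' B').
Proof.
move=> sA sB; apply: gcommg_sub (subgroup_ggen _) _ => a b /sA Aa /sB Bb.
exact: gcommg_mem.
Qed.

Lemma lcs_mono H K i : gsub H K -> gsub (lcs H i) (lcs K i).
Proof. by move=> sHK; elim: i => //= i IHi; apply: gcommg_mono. Qed.

Lemma derived_mono H K i : gsub H K -> gsub (derived H i) (derived K i).
Proof. by move=> sHK; elim: i => //= i IHi; apply: gcommg_mono. Qed.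

Lemma derived_add H i j : derived H (i + j) = derived (derived H i) j.
Proof. by elim: j => [|j IHj]; rewrite ?addn0 // addnS /= IHj. Qed.

Lemma nilpotent_class_le_mono n H K :
  gsub H K -> nilpotent_class_le n K -> nilpotent_class_le n H.
Proof. by move=> sHK nK x /(lcs_mono sHK); apply: nK. Qed.

Lemma subgroup_derived H i : subgroup H -> subgroup (derived H i).
Proof. by case: i => //= i _; apply: subgroup_ggen. Qed.

Lemma derived_decr H i : subgroup H -> gsub (derived H i.+1) (derived H i).
Proof.
move=> sH; apply: gcommg_sub (subgroup_derived i sH) _ => a b Da Db.
by apply: subgroup_comm => //; apply: subgroup_derived.
Qed.

Lemma soluble_dl_le_leq d e H :
  subgroup H -> d <= e -> soluble_dl_le d H -> soluble_dl_le e H.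
Proof.
move=> sH /subnKC <-; elim: (e - d) => [|k IHk]; rewrite ?addn0 // addnS.
by move=> dH x /derived_decr-/(_ sH); apply: IHk.
Qed.

(** * The lower central series and its relation to the derived series *)

Section LowerCentralSeries.
Variable H : G -> Prop.
Hypothesis sH : subgroup H.

Lemma subgroup_lcs i : subgroup (lcs H i).
Proof. by case: i => //= i; apply: subgroup_ggen. Qed.

Lemma lcs_gnormalised i : gnormalised (lcs H i) H.
Proof.
elim: i => [|i IHi] g x Hg; first exact: subgroup_conj.
apply: (@gcommg_sub _ _ (fun x => lcs H i.+1 (gconj x g))).
  exact/subgroup_preconj/subgroup_lcs.
move=> a b La Hb; rewrite gcommJ; apply: gcommg_mem; first exact: IHi.
exact: subgroup_conj.
Qed.

Lemma lcs_decr i : gsub (lcs H i.+1) (lcs H i).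
Proof.
have [l1 [lM lV]] := subgroup_lcs i.
apply: gcommg_sub (subgroup_lcs i) _ => a b La Hb; rewrite gcommE.
by apply: lM; [apply: lV | apply: lcs_gnormalised].
Qed.

Lemma lcs_sub i j : i <= j -> gsub (lcs H j) (lcs H i).
Proof.
move/subnKC <-; elim: (j - i) => [|k IHk] x; rewrite ?addn0 // addnS.
by move/lcs_decr; apply: IHk.
Qed.

Lemma lcs_in i : gsub (lcs H i) H.
Proof. exact: (lcs_sub (leq0n i)). Qed.

(** Since [lcs H i] is $\gamma_{i+1}(H)$, this is $[\gamma_{i+1},\gamma_{j+1}] \le \gamma_{i+j+2}$,
    proved by induction on [j] as in the three subgroups lemma. *)
Lemma lcs_comm i j a b : lcs H i a -> lcs H j b -> lcs H (i + j).+1 (gcomm a b).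
Proof.
elim: j i a b => [|j IHj] i a b La Lb; first by rewrite addn0; apply: gcommg_mem.
have sL := subgroup_lcs (i + j.+1).+1; have [l1 [lM lV]] := sL.
have nL := @lcs_gnormalised (i + j.+1).+1.
(* These [b] form a subgroup, so generators [gcomm u h] suffice; [H b] is carried along because the
   product and inverse formulas conjugate by such elements. *)
suff [] : H b /\ forall c, lcs H i c -> lcs H (i + j.+1).+1 (gcomm c b).
  by move=> _; apply.
have [h1 [hM hV]] := sH.
apply: (@gcommg_sub _ _ (fun b =>
  H b /\ forall c, lcs H i c -> lcs H (i + j.+1).+1 (gcomm c b))) Lb.
  split; first by split=> // c _; rewrite /gcomm !gE.
  split=> [x y [Hx Lx] [Hy Ly] | x [Hx Lx]].
    split=> [|c Lc]; first exact: hM.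
    have -> : gcomm c (x * y) = gcomm c y * gconj (gcomm c x) y.
      by rewrite /gcomm /gconj !gE.
    by apply: lM; [apply: Ly | apply: nL => //; apply: Lx].
  split=> [|c Lc]; first exact: hV.
  have -> : gcomm c x^-1 = gconj (gcomm c x)^-1 x^-1 by rewrite /gcomm /gconj !gE.
  by apply: nL; [apply: hV | apply: lV; apply: Lx].
move=> u h Lu Hh; have Hu := lcs_in Lu.
split=> [|c Lc]; first exact: subgroup_comm.
have Hc := lcs_in Lc.
have [_ [_ iV]] := subgroup_lcs i; have [_ [_ jV]] := subgroup_lcs j.
rewrite -gcommV; apply: (lV).
(* The factor [p] is a conjugate of the wanted commutator; induction puts [q] and [r] into the
   target term. *)
have := Hall_Witt u h^-1 c; rewrite ginvK.
set p := gconj _ _; set q := gconj _ _; set r := gconj _ _ => eq1.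
have Lq : lcs H (i + j.+1).+1 q.
  apply: nL => //; rewrite -addSnnS; apply: IHj => //.
  rewrite -gcommV; apply: ((subgroup_lcs i.+1).2.2).
  by apply: gcommg_mem; [apply: iV | apply: hV].
have Lr : lcs H (i + j.+1).+1 r.
  apply: nL => //; rewrite addnS; apply: gcommg_mem; last exact: hV.
  by apply: IHj => //; apply: jV.
have Lp : lcs H (i + j.+1).+1 p.
  have -> : p = (q * r)^-1 by apply: (@gmulI p^-1); apply: (@gmulI p);
    rewrite -[RHS]gmul1 -eq1 !gE.
  by apply: lV; apply: lM.
exact: gnormalised_mem sH nL (hV _ Hh) Lp.
Qed.

(** By [lcs_comm], each derived step doubles the weight; the predecessor appears because [lcs]
    counts from 0. *)
Lemma derived_lcs k : gsub (derived H k) (lcs H (2 ^ k).-1).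
Proof.
elim: k => [|k IHk] //=; have -> : (2 ^ k.+1).-1 = ((2 ^ k).-1 + (2 ^ k).-1).+1.
  by rewrite expnS; have := expn_gt0 2 k; lia.
apply: gcommg_sub (subgroup_lcs _) _ => a b /IHk La /IHk Lb.
exact: lcs_comm.
Qed.

Lemma nilpotent_soluble n : nilpotent_class_le n H -> soluble_dl_le (trunc_log 2 n).+1 H.
Proof.
move=> nH x /derived_lcs Lx; apply: nH; apply: lcs_sub Lx.
(* The exponent satisfies [n < 2 ^ (trunc_log 2 n).+1], also for [n = 0], where [trunc_log] is 0. *)
by have := trunc_log_ltn n (isT : 1 < 2); lia.
Qed.

(** An element of the series is a word in iterated commutators and involves finitely many elements
    of [H]. So class at most [n] can be tested on finitely generated subgroups. *)
Lemma lcs_fin_generated i x : lcs H i x ->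
  exists2 l : list G, (forall a, List.In a l -> H a) &
    lcs (ggen (fun a => List.In a l)) i x.
Proof.
elim: i x => [|i IHi] x.
  move=> Hx; exists [:: x] => [a [<-|//] //|].
  by apply: ggen_mem; left.
have catP l1 l2 j : gsub (lcs (ggen (fun a => List.In a l1)) j)
    (lcs (ggen (fun a => List.In a (l1 ++ l2)%list)) j).
  by apply: lcs_mono; apply: ggen_mono => a al; apply/List.in_app_iff; left.
have catPr l1 l2 j : gsub (lcs (ggen (fun a => List.In a l2)) j)
    (lcs (ggen (fun a => List.In a (l1 ++ l2)%list)) j).
  by apply: lcs_mono; apply: ggen_mono => a al; apply/List.in_app_iff; right.
apply: (@gcommg_sub _ _ (fun x => exists2 l : list G,
  (forall a, List.In a l -> H a) & lcs (ggen (fun a => List.In a l)) i.+1 x)).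
  have sL (l : list G) : subgroup (lcs (ggen (fun a => List.In a l)) i.+1).
    by rewrite /=; apply: subgroup_ggen.
  split; first by exists [::] => //; case: (sL [::]).
  split=> [y z [l1 H1 L1] [l2 H2 L2] | y [l Hl Ll]].
    exists (l1 ++ l2)%list; first by move=> a /List.in_app_iff[]; [apply: H1 | apply: H2].
    have [_ [lM _]] := sL (l1 ++ l2)%list.
    by apply: lM; [apply: (catP l1 l2 i.+1) | apply: (catPr l1 l2 i.+1)].
  by exists l => //; apply: (sL l).2.2.
move=> a b /IHi[l Hl La] Hb; exists (b :: l)%list.
  by move=> c [<-|/Hl].
apply: gcommg_mem; first exact: (catPr [:: b] l i).
by apply: ggen_mem; left.
Qed.

End LowerCentralSeries.
End Groups.

(** * Images and preimages under a map to a finite group that is multiplicative on [H] *)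

Section FiniteImage.
Variables (G : Grp) (H : G -> Prop) (gT : finGroupType) (f : G -> gT).
Hypothesis sH : subgroup H.
Hypothesis fM : forall x y, H x -> H y -> f (gmul x y) = (f x * f y)%g.
Local Open Scope group_scope.

Lemma fin_image1 : f (gone G) = 1.
Proof. by apply: (mulgI (f (gone G))); rewrite -fM ?gmul1 ?mulg1; case: sH. Qed.

Lemma fin_imageV x : H x -> f (ginv x) = (f x)^-1.
Proof.
move=> Hx; apply: (mulgI (f x)); rewrite -fM ?gmulrV ?fin_image1 ?mulgV //.
exact: sH.2.2.
Qed.

Lemma fin_image_comm x y : H x -> H y -> f (gcomm x y) = [~ f x, f y].
Proof.
move=> Hx Hy; have [_ [hM hV]] := sH.
have [Hx' Hy'] := (hV _ Hx, hV _ Hy).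
have Hxy := hM _ _ Hx' Hy'; have Hxyx := hM _ _ Hxy Hx.
by rewrite /gcomm (fM Hxyx Hy) (fM Hxy Hx) (fM Hx' Hy') !fin_imageV // /commg /conjg !mulgA.
Qed.

(** Classical logic turns the existential into a boolean, which makes the image a finite set. *)
Definition fin_image (K : G -> Prop) : {set gT} := [set y | `[< exists2 x, K x & f x = y >]].

Lemma fin_imageP (K : G -> Prop) y : reflect (exists2 x, K x & f x = y) (y \in fin_image K).
Proof. by rewrite inE; apply: asboolP. Qed.

Lemma fin_image_group_set (K : G -> Prop) : subgroup K -> gsub K H -> group_set (fin_image K).
Proof.
move=> [k1 [kM kV]] sKH; apply/group_setP; split.
  by apply/fin_imageP; exists (gone G) => //; exact: fin_image1.
move=> _ _ /fin_imageP[x Kx <-] /fin_imageP[y Ky <-]; apply/fin_imageP.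
by exists (gmul x y); [apply: kM | apply: fM; apply: sKH].
Qed.

Lemma subgroup_preimage (A : {group gT}) : subgroup (fun x => H x /\ f x \in A).
Proof.
have [h1 [hM hV]] := sH; split; first by rewrite fin_image1 group1.
split=> [x y [Hx Ax] [Hy Ay] | x [Hx Ax]].
  by split; [apply: hM | rewrite fM ?groupM].
by split; [apply: hV | rewrite fin_imageV ?groupV].
Qed.

Lemma nilpotent_fin_image (L : {group gT}) n :
  L \subset fin_image H -> nilpotent_class_le n H -> nilpotent L.
Proof.
move=> sLH nH.
(* The finite series starts at ['L_1(L) = L], whence the shift. *)
have sub i : 'L_i.+1(L) \subset fin_image (lcs H i).
  elim: i => [|i IHi]; first by rewrite lcn1.
  have gI := fin_image_group_set (subgroup_lcs sH i.+1) (lcs_in sH (i := i.+1)).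
  rewrite lcnSn -[fin_image _]/(gval (Group gI)) gen_subG /=.
  apply/subsetP => _ /imset2P[_ _ /(subsetP IHi)/fin_imageP[a La <-]
    /(subsetP sLH)/fin_imageP[b Hb <-] ->].
  apply/fin_imageP; exists (gcomm a b); first exact: gcommg_mem.
  by apply: fin_image_comm => //; apply: lcs_in La.
apply/lcnP; exists n; apply/trivgP/subsetP => y /(subsetP (sub n))/fin_imageP[x Lx <-].
by rewrite (nH x Lx) fin_image1 group1.
Qed.

End FiniteImage.

(** * Minimal bad subgroups and their derived subgroups *)

Section Minimal.
Variable G : Grp.
Implicit Types (x y z g h : G) (H K M N S A : G -> Prop).

(** Induction on the length of a list that covers the subgroups of [H] with [P]: passing to a
    smaller such [K] frees the entry of [H]. *)
Lemma minimal_subgroup_exists (P : (G -> Prop) -> Prop) (l : list (G -> Prop)) H :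
  (forall K, subgroup K -> P K -> gsub K H -> exists L, List.In L l /\ same_set K L) ->
  subgroup H -> P H ->
  exists M, [/\ subgroup M, P M, gsub M H &
    forall K, subgroup K -> gsub K M -> ~ gsub M K -> ~ P K].
Proof.
have [k] := ubnP (length l); elim: k l H => // k IHk l H lek lP sH PH.
have [[K [sK PK sKH nHK]]|min] :=
  EM (exists K, [/\ subgroup K, P K, gsub K H & ~ gsub H K]); last first.
  exists H; split=> // K sK sKH nHK PK; by apply: min; exists K.
have [L [Ll eHL]] := lP H sH PH (fun _ => id).
have [l1 [l2 def_l]] := List.in_split _ _ Ll.
have [||M [sM PM sMK minM]] := IHk (l1 ++ l2)%list K _ _ sK PK.
- by move: lek; rewrite def_l !List.length_app /=; lia.
- move=> J sJ PJ sJK; have [L' [L'l eJ]] := lP J sJ PJ (fun x Jx => sKH x (sJK x Jx)).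
  exists L'; split=> //; move: L'l; rewrite def_l; rewrite !List.in_app_iff /=.
  case=> [|[eL|]]; [by left | | by right].
  (* If [J] were matched with the removed entry it would equal [H], giving [H] inside [K]. *)
  by case: nHK => x Hx; apply: sJK; apply/eJ; rewrite -eL; apply/eHL.
by exists M; split=> // x /sMK/sKH.
Qed.

(** A nontrivial finite image [I] of [M] is soluble, so the preimage of its derived subgroup is a
    proper subgroup of [M] containing [M']. *)
Lemma minimal_derived_nilpotent n M : locally_graded G -> subgroup M ->
  ~ nilpotent_class_le n M ->
  (forall K, subgroup K -> gsub K M -> ~ gsub M K -> nilpotent_class_le n K) ->
  nilpotent_class_le n (derived M 1).
Proof.
move=> lgG sM nM minM.
have [x Lx ntx] : exists2 x, lcs M n x & x <> gone G.
  by apply: contrapT => ne; apply: nM => x Lx; apply: contrapT => ntx; apply: ne; exists x.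
have [l lM lx] := lcs_fin_generated Lx.
(* The list [l] generates [M]: otherwise its span would have class at most [n], yet [x] is a
   nontrivial element of the corresponding term. *)
have fgM : fin_generated M.
  exists l => y; split; last exact: (ggen_sub sM).
  apply: contrapT => nMl; apply: ntx.
  apply: (minM (ggen (fun a => List.In a l))) lx; first exact: subgroup_ggen.
    exact: ggen_sub.
  by move=> sMl; apply: nMl; apply: sMl.
have ntM : ~ gtrivial M by move=> /(_ x (lcs_in sM Lx)).
have [gT [f [fM [y [My nty]]]]] := lgG M sM fgM ntM.
pose I := Group (fin_image_group_set sM fM sM (fun _ => id)).
have proper_nil (L : {group gT}) : L \proper I ->
    nilpotent_class_le n (fun x => M x /\ f x \in L).
  case/properP=> _ [_ /fin_imageP[z Mz <-] nLz]; apply: minM.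
  - exact: subgroup_preimage.
  - by move=> ? [].
  - by move=> /(_ z Mz)[_ Lz]; rewrite Lz in nLz.
have solI : solvable I.
  apply: solvable_proper_nilpotent => L prL.
  apply: (nilpotent_fin_image (f := f) (subgroup_preimage sM fM L) _ _ (proper_nil L prL)).
    by move=> u v [Mu _] [Mv _]; apply: (fM).
  apply/subsetP=> z Lz; have /fin_imageP[u Mu eu] := subsetP (proper_sub prL) z Lz.
  by apply/fin_imageP; exists u; rewrite ?eu.
have ntI : I :!=: 1%g.
  apply/trivgPn; exists (f y); last exact/eqP.
  by apply/fin_imageP; exists y.
have prD := sol_der1_proper solI (subxx _) ntI.
apply: nilpotent_class_le_mono (proper_nil _ prD).
apply: gcommg_sub; first exact: subgroup_preimage.
move=> a b Ma Mb; split; first exact: subgroup_comm.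
by rewrite (fin_image_comm sM fM) //= mem_commg //; apply/fin_imageP; [exists a | exists b].
Qed.

End Minimal.

(** * Integer powers as differences of natural exponents *)

Section Powers.
Variable G : Grp.
Local Notation "x * y" := (gmul x y).
Local Notation "1" := (gone G).
Local Notation "x ^-1" := (ginv x).
Implicit Types (x y z g h : G).

Definition gpow x k := iter k (gmul x) 1.

Lemma gpowD x a b : gpow x (a + b) = gpow x a * gpow x b.
Proof. by rewrite /gpow; elim: a => [|a IHa]; rewrite ?gmul1 //= IHa gmulA. Qed.

(* The integer power [x ^ (a - b)]. *)
Definition gzpow x a b := gpow x a * (gpow x b)^-1.

Lemma gzpowM x a b c d : gzpow x a b * gzpow x c d = gzpow x (a + c) (b + d).
Proof.
have comm : (gpow x b)^-1 * gpow x c = gpow x c * (gpow x b)^-1.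
  apply: (@gmulI _ (gpow x b)); rewrite gmulVK gmulA -gpowD addnC gpowD.
  by rewrite gmulAr gmulrV gmulr1.
by rewrite /gzpow (addnC b) !gpowD ginvM !gmulAr (gmulA (gpow x b)^-1) comm !gmulAr.
Qed.

Lemma gzpowV x a b : (gzpow x a b)^-1 = gzpow x b a.
Proof. by rewrite /gzpow ginvM ginvK. Qed.

Lemma gpow_gzpow x a b k : gpow (gzpow x a b) k = gzpow x (k * a) (k * b).
Proof.
elim: k => [|k IHk]; first by rewrite /gzpow /gpow /= gmulrV.
by rewrite /= -/(gpow _ k) IHk gzpowM !mulSn.
Qed.

(** Both sides are $x^{(a-b)(c-d)}$. *)
Lemma gzpowC x a b c d : gzpow (gzpow x a b) c d = gzpow (gzpow x c d) a b.
Proof.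
rewrite [LHS]/gzpow [RHS]/gzpow !gpow_gzpow !gzpowV !gzpowM.
by congr gzpow; lia.
Qed.

Lemma gconj_pow x g a : gconj (gpow x a) g = gpow (gconj x g) a.
Proof. by elim: a => [|a IHa]; rewrite ?gconj1l //= gconjMl IHa. Qed.

Lemma gconj_zpow x g a b : gconj (gzpow x a b) g = gzpow (gconj x g) a b.
Proof. by rewrite /gzpow gconjMl gconjV !gconj_pow. Qed.

End Powers.

(** * Dedekind quotients: all subgroups between [M] and [S] are normalised by [S] *)

Section Dedekind.
Variables (G : Grp) (S M : G -> Prop).
Local Notation "x * y" := (gmul x y).
Local Notation "1" := (gone G).
Local Notation "x ^-1" := (ginv x).
Implicit Types (x y z g h : G).
Hypotheses (sS : subgroup S) (sM : subgroup M) (sMS : gsub M S) (nM : gnormalised M S).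
Hypothesis nS : forall K, subgroup K -> gsub M K -> gsub K S -> gnormalised K S.

(** Equality of the cosets $xM$ and $yM$; computing with this congruence replaces forming $S/M$. *)
Definition eqm x y := M (x^-1 * y).

Lemma eqm_refl x : eqm x x.
Proof. by rewrite /eqm gmulV; case: sM. Qed.

Lemma eqm_sym x y : eqm x y -> eqm y x.
Proof. by move=> e; have := sM.2.2 _ e; rewrite ginvM ginvK. Qed.

Lemma eqm_trans y x z : eqm x y -> eqm y z -> eqm x z.
Proof. by move=> e1 e2; have := sM.2.1 _ _ e1 e2; rewrite !gE. Qed.

Lemma eqmM x y z w : S z -> eqm x y -> eqm z w -> eqm (x * z) (y * w).
Proof.
move=> Sz e1 e2; have := sM.2.1 _ _ (nM Sz e1) e2.
by rewrite /eqm /gconj !gE.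
Qed.

Lemma eqmV x y : S x -> eqm x y -> eqm x^-1 y^-1.
Proof.
move=> Sx e; have := nM (sS.2.2 _ Sx) (eqm_sym e).
by rewrite /eqm /gconj !gE.
Qed.

Lemma eqmJ x y g : S g -> eqm x y -> eqm (gconj x g) (gconj y g).
Proof. by move=> Sg /(nM Sg); rewrite /eqm gconjMl gconjV. Qed.

Lemma gpow_in x a : S x -> S (gpow x a).
Proof.
move=> Sx; elim: a => [|a IHa]; first by case: sS.
exact: sS.2.1.
Qed.

Lemma gzpow_in x a b : S x -> S (gzpow x a b).
Proof. by move=> Sx; apply: sS.2.1; [|apply: sS.2.2]; apply: gpow_in. Qed.

Lemma eqm_pow x y a : S x -> eqm x y -> eqm (gpow x a) (gpow y a).
Proof.
move=> Sx e; elim: a => [|a IHa]; first exact: eqm_refl.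
by apply: eqmM => //; apply: gpow_in.
Qed.

Lemma eqm_zpow x y a b : S x -> eqm x y -> eqm (gzpow x a b) (gzpow y a b).
Proof.
move=> Sx e; apply: eqmM; first by apply: sS.2.2; apply: gpow_in.
  exact: eqm_pow.
by apply: eqmV; [apply: gpow_in | apply: eqm_pow].
Qed.

Lemma eqm_conj_zpow x g : S x -> S g -> exists a b, eqm (gzpow x a b) (gconj x g).
Proof.
move=> Sx Sg; have [s1 [sMul sV]] := sS.
(* This is the subgroup $\langle x\rangle M$, which [nS] makes stable under conjugation by [g]. *)
pose T y := S y /\ exists a b, eqm (gzpow x a b) y.
have [] // : T (gconj x g).
apply: (nS (K := T)) => //.
- split; first by split=> //; exists 0, 0; rewrite /gzpow gmulrV; apply: eqm_refl.
  split=> [y z [Sy [a [b ey]]] [Sz [c [d ez]]] | y [Sy [a [b ey]]]].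
    split; first exact: sMul.
    by exists (a + c), (b + d); rewrite -gzpowM; apply: eqmM => //; apply: gzpow_in.
  split; first exact: sV.
  by exists b, a; rewrite -gzpowV; apply: eqmV => //; apply: gzpow_in.
- move=> y My; split; first exact: sMS.
  by exists 0, 0; rewrite /gzpow gmulrV /eqm ginv1 gmul1.
- by move=> y [].
split=> //; exists 1%N, 0; rewrite /gzpow /gpow /= !gE; exact: eqm_refl.
Qed.

(* Automorphisms of the cyclic group generated by [x] modulo [M] commute. *)
Lemma eqm_conjC x g h : S x -> S g -> S h -> eqm (gconj x (g * h)) (gconj x (h * g)).
Proof.
move=> Sx Sg Sh.
have [a [b eg]] := eqm_conj_zpow Sx Sg; have [c [d eh]] := eqm_conj_zpow Sx Sh.
rewrite !gconjM; apply: (eqm_trans (eqm_sym (eqmJ Sh eg))).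
apply: eqm_trans (eqmJ Sg eh); rewrite !gconj_zpow.
apply: (eqm_trans (eqm_sym (eqm_zpow a b (gzpow_in c d Sx) eh))).
by rewrite gzpowC; apply: eqm_zpow eg; apply: gzpow_in.
Qed.

(** Conjugations commute on each element modulo [M], so commutators act trivially: $S'$ is central
    modulo [M]. *)
Lemma Dedekind_derived2 : gsub (derived S 2) M.
Proof.
have [s1 [sMul sV]] := sS.
have cent : gsub (derived S 1) (fun z => S z /\ forall x, S x -> eqm x (gconj x z)).
  apply: gcommg_sub.
    split; first by split=> // x _; rewrite gconj1; apply: eqm_refl.
    split=> [y z [Sy cy] [Sz cz] | y [Sy cy]].
      split=> [|x Sx]; first exact: sMul.
      by rewrite gconjM; apply: eqm_trans (cz x Sx) (eqmJ Sz (cy x Sx)).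
    split=> [|x Sx]; first exact: sV.
    by have := eqmJ (sV y Sy) (cy x Sx); rewrite gconjK => /eqm_sym.
  move=> g h Sg Sh; split=> [|x Sx]; first exact: subgroup_comm.
  have Shg := sMul h g Sh Sg.
  (* Applied to this conjugate of [x], [eqm_conjC] compares [x] with its conjugate by
     [gcomm g h]. *)
  have Sy : S (gconj x (h * g)^-1) by apply: subgroup_conj => //; apply: sV.
  have := eqm_conjC Sy Sh Sg; rewrite gconjVK -gconjM.
  by rewrite (_ : _ * _ = gcomm g h) // /gcomm !gE.
apply: gcommg_sub => // a b /cent[Sa _] /cent[_ cb].
by rewrite gcommE; apply: cb.
Qed.

End Dedekind.

(** * The conjugation action on the bad subgroups and its kernel *)

Section Normaliser.
Variables (G : Grp) (n : nat).
Local Notation "x * y" := (gmul x y).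
Local Notation "x ^-1" := (ginv x).
Implicit Types (x y z g h : G) (H K : G -> Prop).

(** The bad subgroups; despite the name they include nilpotent ones of class above [n]. *)
Definition nonnil H := subgroup H /\ ~ nilpotent_class_le n H.

Lemma lcs_preconj K g i x : subgroup K ->
  lcs K i x -> lcs (fun y => K (gconj y g)) i (gconj x g^-1).
Proof.
move=> sK; elim: i x => [|i IHi] x; first by rewrite /= gconjVK.
apply: (@gcommg_sub _ _ _ (fun x => lcs (fun y => K (gconj y g)) i.+1 (gconj x g^-1))).
  by apply/subgroup_preconj/subgroup_lcs/subgroup_preconj.
move=> a b La Kb; rewrite gcommJ; apply: gcommg_mem; first exact: IHi.
by rewrite gconjVK.
Qed.

Lemma nonnil_preconj K g : nonnil K -> nonnil (fun y => K (gconj y g)).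
Proof.
case=> sK nK; split; first exact: subgroup_preconj.
move=> nJ; apply: nK => x /(lcs_preconj g sK)/nJ e.
by rewrite -(gconjVK x g) e gconj1l.
Qed.

(** The intersection of the normalisers of the bad subgroups. The equivalence matters: in an
    infinite group a conjugate of [K] may be a proper subgroup of [K]. *)
Definition nonnil_kernel g := forall K, nonnil K -> forall x, K x <-> K (gconj x g).

Lemma nonnil_kernel_normal : gnormal nonnil_kernel.
Proof.
split; last first.
  (* The element [s] normalises the bad subgroup $gKg^{-1}$, so its conjugate $g^{-1}sg$ normalises
     [K]. *)
  move=> g s Ss K nK x; have := Ss _ (nonnil_preconj g nK) (gconj x g^-1).
  by rewrite gconjVK -!gconjM gmulA.
split; first by move=> K _ x; rewrite gconj1.
split=> [g h Sg Sh K nK x | g Sg K nK x].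
  by rewrite gconjM; apply: iff_trans (Sg K nK x) (Sh K nK _).
by rewrite -{1}(gconjVK x g); apply: iff_sym; apply: Sg.
Qed.

(** One witness is kept for each [p] that has any. With [s] listing the permutations, this bounds
    the number of cosets. *)
Lemma representatives (T : eqType) (R : G -> T -> Prop) (s : seq T) :
  exists2 r : list G, length r <= size s &
    forall p, p \in s -> forall g, R g p -> exists2 x, List.In x r & R x p.
Proof.
elim: s => [|p s [r ler rP]]; first by exists [::].
have [[x Rx]|nR] := EM (exists x, R x p).
  exists (x :: r) => [//|q]; rewrite inE => /predU1P[->|qs] g Rg.
    by exists x => //; left.
  by have [y yr Ry] := rP q qs g Rg; exists y => //; right.
exists r => [|q]; first exact: leqW.
rewrite inE => /predU1P[->|qs] g Rg; first by case: nR; exists g.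
exact: rP qs g Rg.
Qed.

Lemma nonnil_kernel_index m :
  exactly_subgroups m (fun H : G -> Prop => ~ nilpotent_class_le n H) ->
  quotient_order_le nonnil_kernel m`!.
Proof.
case=> l [<- {m} [lnil [lP linj]]].
pose K i : G -> Prop := List.nth i l (fun _ => False).
have nonnilP H : nonnil H -> exists i : 'I_(length l), same_set H (K i).
  case=> sH nH; have [L [Ll eL]] := lP H sH nH.
  have [i [/ltP lti def_L]] := List.In_nth l L (fun _ => False) Ll.
  by exists (Ordinal lti); rewrite /K /= def_L.
have nonnilK (i : 'I_(length l)) : nonnil (K i).
  by have [] := lnil (K i) (List.nth_In _ _ (elimT ltP (ltn_ord i))).
(* That is, $gK_ig^{-1} = K_{p(i)}$. *)
pose R g (p : 'S_(length l)) := forall (i : 'I_(length l)) x, K i (gconj x g) <-> K (p i) x.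
have [r ler rP] := representatives R (enum [set: 'S_(length l)]).
exists r; split; first by move: ler; rewrite -cardE cardsT card_Sn.
move=> g; have [p Rp] : exists p, R g p.
  have [s sP] := fin_all_exists (fun i => nonnilP _ (nonnil_preconj g (nonnilK i))).
  (* Conjugation is invertible and the list has no repetitions up to [same_set]. *)
  have inj_s : injective s.
    move=> i j eqs; apply: val_inj; apply: linj; rewrite ?ltn_ord // => x.
    by rewrite -/(K i) -/(K j) -(gconjVK x g) (sP i) (sP j) eqs.
  by exists (perm inj_s) => i x; rewrite permE; apply: sP.
have [|x xr Rx] := rP p _ g Rp; first by rewrite mem_enum inE.
(* As [x] and [g] induce the same permutation, $x^{-1}g$ normalises every [K i]. *)
exists x; split=> // H /nonnilP[i eH] y; rewrite !eH gconjM.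
by rewrite (Rp i) -(Rx i) gconjVK.
Qed.

End Normaliser.

(** * The derived length of the kernel *)

Theorem theoremA (m n : nat) (G : Grp) :
  @locally_graded G ->
  @exactly_subgroups G m (fun H => ~ nilpotent_class_le n H) ->
  exists S : G -> Prop,
    gnormal S /\
    soluble_dl_le (trunc_log 2 n + m + 3) S /\
    quotient_order_le S m`!.
Proof.
move=> lgG exG; exists (nonnil_kernel n).
have nS := nonnil_kernel_normal G n; have sS := nS.1.
split=> //; split; last exact: nonnil_kernel_index.
have [nilS|nnS] := EM (nilpotent_class_le n (nonnil_kernel (G := G) n)).
  by apply: soluble_dl_le_leq (nilpotent_soluble sS nilS) => //; lia.
case: exG => l [len_l [_ [lP _]]].
have m_gt0 : 0 < m.
  by have [K []] := lP _ sS nnS; rewrite -len_l; case: (l).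
have [|M [sM nM sMS minM]] := minimal_subgroup_exists
    (P := fun H => ~ nilpotent_class_le n H) (l := l) _ sS nnS.
  by move=> K sK nK _; apply: lP.
(* A subgroup above [M] is bad too, hence normalised by the kernel by definition. *)
have normS K : subgroup K -> gsub M K -> gnormalised K (nonnil_kernel n).
  move=> sK sMK g x Sg Kx; apply: (Sg K _ x).1 => //; split=> //.
  by move=> nilK; apply: nM; apply: nilpotent_class_le_mono nilK.
have S2M : gsub (derived (nonnil_kernel n) 2) M.
  by apply: Dedekind_derived2 => // [|K sK sMK _]; apply: normS.
have nilM' : nilpotent_class_le n (derived M 1).
  by apply: minimal_derived_nilpotent => // K sK sKM nMK; apply: contrapT; apply: minM.
have solM' := nilpotent_soluble (subgroup_derived 1 sM) nilM'.
(* Two steps lead into [M], one to [M'], the rest to the trivial group; the total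
   [trunc_log 2 n + 4] fits the bound because [m_gt0] holds. *)
apply: (@soluble_dl_le_leq _ (2 + (1 + (trunc_log 2 n).+1))) => //; first by lia.
move=> x; rewrite derived_add => /(derived_mono S2M); rewrite derived_add.
exact: solM'.
Qed.
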